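(* Let $C$ be a nonempty convex weakly compact subset of a Banach space $X$ and let $\mathcal T=\{T_t:t\in G\}$ be an asymptotically regular semigroup on $C$. Let $s(\mathcal T)=\liminf_t|T_t|$. Assume that (a) $s(\mathcal T)<\sqrt{\operatorname{WCS}(X)}$, or (b) $s(\mathcal T)<1+r_X(1)$. Then $\mathcal T$ has a fixed point in $C$ and $\operatorname{Fix}\mathcal T=\{x\in C:T_tx=x,\ t\in G\}$ is a Hölder continuous retract of $C$.
   Context: $G$ is an unbounded subset of $[0,\infty)$ such that $t+s,\,t-s\in G$ for all $t,s\in G$ with $t>s$. A (nonlinear) semigroup on $C$ is a family $\mathcal T=\{T_t:t\in G\}$ of mappings $T_t:C\to C$ with $T_{t+s}x=T_tT_sx$ for all $t,s\in G$, $x\in C$ (no continuity in $t$ is assumed). It is asymptotically regular if $\lim_t\|T_{t+h}x-T_tx\|=0$ for every $x\in C$ and $h\in G$. Limits and lower limits in $t$ are taken as $t\to\infty$ in $G$. For $T:C\to C$, $|T|=\inf\{k:\|Tx-Ty\|\le k\|x-y\|\ \text{for all } x,y\in C\}$ is the exact Lipschitz constant, with $|T|=\infty$ if $T$ is not Lipschitzian. $\operatorname{WCS}(X)$ is the weakly convergent sequence coefficient: if $X$ does not have the Schur property (the property that every weakly convergent sequence is norm convergent), $\operatorname{WCS}(X)=\sup\{k: k\,r_a(x_n)\le\operatorname{diam}_a(x_n)\ \text{for each weakly null sequence } (x_n) \text{ in } X\}$, where $r_a(x_n)=\inf\{\limsup_n\|x_n-y\|: y\in\overline{\operatorname{conv}}(\{x_n:n\in\mathbb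 N\})\}$ and $\operatorname{diam}_a(x_n)=\inf_n\sup_{i,j\ge n}\|x_i-x_j\|$; if $X$ has the Schur property, $\operatorname{WCS}(X)=2$. $r_X$ is the Opial modulus: for $c\ge0$, $r_X(c)=\inf\{\liminf_{n\to\infty}\|x_n+x\|-1\}$, the infimum being over all $x\in X$ with $\|x\|\ge c$ and all weakly null sequences $(x_n)$ in $X$ with $\liminf_{n\to\infty}\|x_n\|\ge1$. A subset $F\subset C$ is a Hölder continuous retract of $C$ if there is a mapping $R:C\to F$ with $Rx=x$ for all $x\in F$ which is Hölder continuous, i.e. $\|Rx-Ry\|\le K\|x-y\|^{\alpha}$ for all $x,y\in C$, for some $K>0$ and $\alpha\in(0,1]$. *)

(* Defs.v *)
From HB Require Import structures.
From mathcomp Require Import all_boot all_order all_algebra.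
From mathcomp Require Import all_classical all_reals all_analysis.

Set Implicit Arguments.
Unset Strict Implicit.
Unset Printing Implicit Defensive.

Import Order.TTheory GRing.Theory Num.Theory.
Import numFieldNormedType.Exports.

Local Open Scope classical_set_scope.
Local Open Scope ring_scope.

Section Weak.
Context {R : realType} (X : normedModType R).

Definition dual : Type := {f : {linear X -> R^o} | continuous f}.

(* X carrying the coarsest topology that makes every element of the dual
   continuous. *)
Definition weak_space : topologicalType :=
  sup_topology
    (fun f : dual => Topological.class (initial_topology (projT1 f : X -> R^o))).

Definition weakly_compact (C : set X) : Prop := compact (C : set weak_space).

Definition weakly_cvg (x : nat -> X) (l : X) : Prop :=
  (x : nat -> weak_space) @ \oo --> (l : weak_space).

Definition weakly_null (x : nat -> X) : Prop := weakly_cvg x 0.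

Definition schur : Prop :=
  forall (x : nat -> X) (l : X), weakly_cvg x l -> x @ \oo --> l.

End Weak.

Section Moduli.
Context {R : realType} {X : normedModType R}.

Definition conv_hull (A : set X) : set X := smallest (@convex_set R X) A.

Definition asymp_radius (x : nat -> X) : \bar R :=
  ereal_inf [set limn_esup (fun n => `|x n - y|%:E) |
             y in closure (conv_hull (range x))].

Definition asymp_diam (x : nat -> X) : \bar R :=
  ereal_inf (range (fun n =>
    ereal_sup [set `|x i - x j|%:E |
               i in [set i | (n <= i)%N] & j in [set j | (n <= j)%N]])).

End Moduli.

(* Without the Schur property the set of k below contains 0 and is bounded by
   2, so its real supremum is the intended one. *)
Definition WCS {R : realType} (X : normedModType R) : R :=
  if `[< schur X >] then 2
  else sup [set k : R | forall x : nat -> X, weakly_null x ->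
              (k%:E * asymp_radius x <= asymp_diam x)%E].

(* Extended-real valued: the infimum is +oo when no sequence is admissible,
   for example when X has the Schur property. *)
Definition opial_modulus {R : realType} (X : normedModType R) (c : R) : \bar R :=
  ereal_inf
    [set (limn_einf (fun n => `|x n + y|%:E) - 1)%E |
     x in [set x : nat -> X | weakly_null x /\
                              (1 <= limn_einf (fun n => `|x n|%:E))%E]
     & y in [set y : X | c <= `|y|]].

Definition admissible_times {R : realType} (G : set R) : Prop :=
  [/\ G `<=` [set t | 0 <= t],
      ~ has_ubound G
    & forall t s, G t -> G s -> s < t -> G (t + s) /\ G (t - s)].

Section Semigroups.
Context {R : realType} {X : normedModType R}.

(* A self-map of C is the restriction of a total map X -> X, and a family
   indexed by G the restriction of a family indexed by R; the definitions below
   only constrain, and only use, the values on C at times in G. *)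

Definition semigroup_on (G : set R) (C : set X) (T : R -> X -> X) : Prop :=
  (forall t x, G t -> C x -> C (T t x)) /\
  (forall t s x, G t -> G s -> C x -> T (t + s) x = T t (T s x)).

Definition infty_in (G : set R) : set_system R := within G (pinfty_nbhs R).

Definition asymptotically_regular (G : set R) (C : set X) (T : R -> X -> X) :
    Prop :=
  forall x h, C x -> G h ->
    (fun t => `|T (t + h) x - T t x|) @ infty_in G --> (0 : R).

(* The condition 0 <= k only matters when C has at most one point. *)
Definition lip_const (C : set X) (f : X -> X) : \bar R :=
  ereal_inf [set k%:E | k in
    [set k : R | 0 <= k /\
       forall x y, C x -> C y -> `|f x - f y| <= k * `|x - y|]].

Definition liminf_lip (G : set R) (C : set X) (T : R -> X -> X) : \bar R :=
  limf_einf (fun t => lip_const C (T t)) (infty_in G).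

Definition Fix (G : set R) (C : set X) (T : R -> X -> X) : set X :=
  [set x | C x /\ forall t, G t -> T t x = x].

Definition holder_retract (C F : set X) : Prop :=
  F `<=` C /\
  exists r : X -> X,
    [/\ forall x, C x -> F (r x),
        forall x, F x -> r x = x
      & exists K alpha : R,
          [/\ 0 < K, 0 < alpha, alpha <= 1
            & forall x y, C x -> C y ->
                `|r x - r y| <= K * `|x - y| `^ alpha]].

End Semigroups.

(* Main.v *)
(* Fix times t_n -> oo in G at which T_(t_n) is s-Lipschitz, s slightly above
   s(T), and an ultrafilter U on nat finer than \oo. By weak compactness
   L x = w-lim_U T_(t_n) x defines an s-Lipschitz self-map of C. The point is a
   constant q < 1 such that the defects d(x) = sup_n |x - T_(t_n) x| satisfy
   d(L x) <= q d(x); then |L^(k+1) x - L^k x| <= q^k diam C, so the L^k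
   converge uniformly to a retraction onto the fixed points, and Hoelder
   continuity follows by interpolating between (s+1)^k |x - y| and O(q^k).

   Put z = L x and r = lim_U |T_(t_n) x - z|. Asymptotic regularity gives
   limsup_n |T_(t_n) x - T_(t_m) w| <= s lim_U |T_(t_n) x - w|, for w = x and for
   w = z. A subsequence of T_(t_n) x converges weakly to z along \oo, since
   countably many functionals separate points of a separable subspace.
   (a) For k < WCS(X), k r <= s d(x) because the subsequence has asymptotic
   diameter at most s d(x), and |z - T_(t_m) z| <= s r; so q = s^2 / k.
   (b) For s < k < 1 + r_X(1), |z - T_(t_m) z| > r would give k r <= s r, and
   points T_(t_i) x at distance about r from z give k r <= s d(x); so q = s / k. *)

Require Import Defs.
From HB Require Import structures.
From mathcomp Require Import all_boot all_order all_algebra.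
From mathcomp Require Import all_classical all_reals all_analysis.
From mathcomp Require Import ring lra.

Import Order.TTheory GRing.Theory Num.Theory.
Import numFieldNormedType.Exports.

Local Open Scope classical_set_scope.
Local Open Scope ring_scope.

(** * A Hahn-Banach theorem for convex functions *)

Definition convex_fun {R : realType} {V : lmodType R} (p : V -> R) : Prop :=
  forall (t : R) x y, 0 <= t -> t <= 1 ->
    p (t *: x + (1 - t) *: y) <= t * p x + (1 - t) * p y.

(** The point 0 is the midpoint of [x] and [- x]. The bound keeps pointwise infima of chains of
    convex minorants finite. *)
Lemma convex_fun_oppr_ge {R : realType} {V : lmodType R} {q : V -> R} :
  convex_fun q -> q 0 = 0 -> forall x, - q (- x) <= q x.
Proof.
move=> cq q0 x; have h0 : 0 <= 2^-1 :> R by rewrite invr_ge0.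
have h1 : 2^-1 <= 1 :> R by rewrite invf_le1 // ler1n.
have := cq _ x (- x) h0 h1.
have -> : (1 - 2^-1) = 2^-1 :> R by lra.
rewrite scalerN subrr q0; lra.
Qed.

Lemma minimal_convex_fun {R : realType} {V : lmodType R} {p : V -> R} :
  convex_fun p -> p 0 = 0 ->
  exists q : V -> R, [/\ convex_fun q, q 0 = 0, forall x, q x <= p x &
    forall q' : V -> R, convex_fun q' -> q' 0 = 0 ->
      (forall x, q' x <= q x) -> q' = q].
Proof.
move=> cp p0.
pose P (q : V -> R) := [/\ convex_fun q, q 0 = 0 & forall x, q x <= p x].
pose T := {q : V -> R | P q}.
(* The order is reversed, so that a maximal element for [le] is a minimal function. *)
pose le (s t : T) : bool := `[< forall x, sval t x <= sval s x >].
have [||||[q [cq q0 qp]] qmin] := @Zorn T le.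
- by move=> t; exact/asboolP.
- move=> r s t /asboolP rs /asboolP st; apply/asboolP => x.
  exact: le_trans (st x) (rs x).
- move=> [s Ps] [t Pt] /asboolP st /asboolP ts; apply/eq_exist/funext => x.
  by apply/eqP; rewrite eq_le; apply/andP; split; [exact: ts|exact: st].
- move=> A tot; have [[s0 As0]|A0] := pselect (exists s, A s); last first.
    have Pp : P p by split.
    by exists (exist _ p Pp) => s As; exfalso; apply: A0; exists s.
  pose E x := [set sval s x | s in A].
  pose m x := inf (E x).
  have lbE x : has_lbound (E x).
    exists (- p (- x)) => _ [[s [cs s0' sp]] As <-] /=.
    by apply: le_trans (convex_fun_oppr_ge cs s0' x); rewrite lerN2.
  have E0 x : E x !=set0 by exists (sval s0 x); exists s0.
  have mle s x : A s -> m x <= sval s x.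
    by move=> As; apply: ge_inf; [exact: lbE|exists s].
  have Pm : P m.
    split.
    + move=> t x y t0 t1; apply/ler_addgt0Pr => e e0.
      have [_ [s As <-] sx] := inf_adherent e0 (conj (E0 x) (lbE x)).
      have [_ [s' As' <-] sy] := inf_adherent e0 (conj (E0 y) (lbE y)).
      (* Totality of the chain yields one member that nearly attains the infimum at both [x] and
         [y]; its convexity passes to [m]. *)
      have [r [Ar rx ry]] : exists r, [/\ A r, sval r x < m x + e
                                           & sval r y < m y + e].
        case: (tot _ _ As As') => /asboolP h.
          by exists s'; split => //; exact: le_lt_trans (h x) sx.
        by exists s; split => //; exact: le_lt_trans (h y) sy.
      apply: le_trans (mle _ (t *: x + (1 - t) *: y) Ar) _.
      case: r Ar rx ry => r [cr r0 rp] /= Ar rx ry.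
      apply: le_trans (cr _ x y t0 t1) _; nra.
    + rewrite /m; suff -> : E 0 = [set 0] by rewrite inf1.
      apply/seteqP; split => [_ [[s [? s0' ?]] As <-] //|_ ->].
      by exists s0 => //; case: s0 As0 => s [? ? ?].
    + move=> x; apply: le_trans (mle _ x As0) _.
      by case: s0 As0 => s [? ? ?] /=.
  exists (exist _ m Pm) => s As; apply/asboolP => x; exact: mle.
- exists q; split => // q' cq' q'0 q'q.
  have Pq' : P q' by split => // x; exact: le_trans (q'q x) (qp x).
  have := qmin (exist _ q' Pq'); rewrite /le /= => h.
  by have /(congr1 sval) := h (introT (asboolP _) q'q).
Qed.

(** A minimal convex minorant vanishing at 0 is linear. Convexity in place of sublinearity admits as
    [p] the increments of a convex function about any point. *)
Lemma convex_hahn_banach {R : realType} {V : lmodType R} {p : V -> R} :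
  convex_fun p -> p 0 = 0 ->
  exists f : {linear V -> R^o}, forall x, f x <= p x.
Proof.
move=> cp p0; have [q [cq q0 qp qmin]] := minimal_convex_fun cp p0.
(* Both [q (l *: _) / l] and [q (_ + a) - q a] are convex minorants of [q]. *)
have hom l x : 0 < l -> l <= 1 -> q (l *: x) = l * q x.
  move=> l0 l1.
  have /(congr1 (fun f : V -> R => l * f x)) /= : (fun x => l^-1 * q (l *: x)) = q;
    last by rewrite mulVKf ?gt_eqF.
  apply: qmin => [t a b t0 t1||a].
  - have -> : l *: (t *: a + (1 - t) *: b) = t *: (l *: a) + (1 - t) *: (l *: b).
      by rewrite scalerDr !scalerA ![l * _]mulrC.
    have /(ler_wpM2l (ltW (_ : 0 < l^-1))) := cq t (l *: a) (l *: b) t0 t1.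
    rewrite invr_gt0 => /(_ l0); lra.
  - by rewrite scaler0 q0 mulr0.
  - have := cq l a 0 (ltW l0) l1; rewrite scaler0 addr0 q0 mulr0 addr0 => h.
    by rewrite mulrC ler_pdivrMr // mulrC.
have dbl x : q (2 *: x) = 2 * q x.
  have := hom 2^-1 (2 *: x); rewrite scalerA mulVf // scale1r => ->; first lra.
    by rewrite invr_gt0.
  by rewrite invf_le1 // ler1n.
have half : 0 <= 2^-1 :> R by rewrite invr_ge0.
have half1 : 2^-1 <= 1 :> R by rewrite invf_le1 // ler1n.
have half2 : 1 - 2^-1 = 2^-1 :> R by lra.
have sub x y : q (x + y) <= q x + q y.
  have := cq _ (2 *: x) (2 *: y) half half1.
  rewrite half2 !scalerA mulVf // !scale1r !dbl; lra.
have add x a : q (x + a) = q x + q a.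
  have /(congr1 (fun f : V -> R => f x)) : (fun x => q (x + a) - q a) = q.
    apply: qmin => [t u v t0 t1||u].
    - have -> : t *: u + (1 - t) *: v + a = t *: (u + a) + (1 - t) *: (v + a).
        by rewrite !scalerDr addrACA -[t *: a + _]scalerDl subrKC scale1r.
      by have := cq t (u + a) (v + a) t0 t1; lra.
    - by rewrite add0r subrr.
    - by have := sub u a; lra.
  by move=> /= h; lra.
have opp x : q (- x) = - q x.
  by have := add x (- x); rewrite subrr q0; lra.
have natm n x : q (n%:R *: x) = n%:R * q x.
  elim: n => [|n IH]; first by rewrite scale0r q0 mul0r.
  by rewrite -addn1 natrD scalerDl scale1r add IH; lra.
(* Since [hom] stops at the factor 1, [l] is written as [l / n] times a natural number [n > l]. *)
have posm l x : 0 < l -> q (l *: x) = l * q x.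
  move=> l0; pose n := (Num.trunc l).+1.
  have ln : l < n%:R by exact: truncnS_gt.
  have n0 : 0 < n%:R :> R by exact: lt_trans ln.
  have -> : l *: x = (l / n%:R) *: (n%:R *: x) by rewrite scalerA divfK ?gt_eqF.
  rewrite hom ?divr_gt0 // ?natm ?mulrA ?divfK ?gt_eqF //.
  by rewrite ler_pdivrMr // mul1r ltW.
have lin : linear (q : V -> R^o).
  move=> l x y; rewrite add; congr (_ + _).
  have [l0|l0|->] := ltgtP l 0.
  - by rewrite -[l]opprK scaleNr opp posm ?oppr_gt0 // -mulNr opprK.
  - exact: posm.
  - by rewrite !scale0r q0.
pose F := GRing.isLinear.Build R V R^o *:%R q lin.
by exists (HB.pack (q : V -> R^o) F : {linear V -> R^o}).
Qed.

(** * Weak limits along filters *)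

(** Testing one functional at a time treats ultrafilters and [\oo] alike and bypasses the topology
    of [weak_space]. *)
Definition wlim {R : realType} {X : normedModType R} {I : Type}
    (F : set_system I) (y : I -> X) (z : X) : Prop :=
  forall (f : dual X) (e : R), 0 < e ->
    F [set i | `|projT1 f (y i) - projT1 f z| < e].

Lemma cvg_weak_space {R : realType} {X : normedModType R} (F : set_system X)
    (z : X) : Filter F ->
  (F --> (z : weak_space X)) <->
  (forall (f : dual X) (e : R), 0 < e ->
     F [set x | `|projT1 f x - projT1 f z| < e]).
Proof.
move=> FF; rewrite /weak_space; split.
  move=> /cvg_sup h f e e0; have := h f; apply.
  apply: (@initial_continuous X R^o (projT1 f : X -> R^o) z
    [set u | `|u - projT1 f z| < e]).
  by apply/nbhs_ballP; exists e => //= x; rewrite /ball /= distrC.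
move=> h; apply/cvg_sup => f A [/= _ [[W oW <-]] Wz /filterS]; apply.
have /nbhs_ballP [e /= e0 eW] : nbhs (projT1 f z : R^o) W by exact: open_nbhs_nbhs.
apply: filterS (h f e e0) => x /= xe; apply: eW.
by rewrite /ball /= distrC.
Qed.

Lemma weakly_cvgP {R : realType} {X : normedModType R} (y : nat -> X) (z : X) :
  weakly_cvg y z <-> wlim \oo y z.
Proof. exact: cvg_weak_space. Qed.

Lemma fmap_ultra {I J : Type} (g : I -> J) {U : set_system I} :
  UltraFilter U -> UltraFilter (g @ U).
Proof.
move=> UU; split; first exact: fmap_proper_filter.
move=> G GF UG; apply/seteqP; split => // A GA.
have [//|UnA] := in_ultra_setVsetC (g @^-1` A) UU.
have /filter_ex [? []//] : G (A `&` ~` A) by apply: filterI => //; exact: UG.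
Qed.

Lemma weakly_compact_wlim {R : realType} {X : normedModType R} {C : set X}
    {I : Type} {U : set_system I} {y : I -> X} :
  weakly_compact C -> UltraFilter U -> (forall i, C (y i)) ->
  exists z, C z /\ wlim U y z.
Proof.
rewrite /weakly_compact compact_ultra => Cwc UU Cy.
have [|z [Cz yz]] := Cwc (y @ U) (fmap_ultra y UU).
  by apply: (@filterS _ U _ setT) filterT => i _; exact: Cy.
by exists z; split=> //; apply/(@cvg_weak_space _ _ (y @ U)).
Qed.

Lemma wlimB {R : realType} {X : normedModType R} {I : Type} {F : set_system I}
    {y y' : I -> X} {z z' : X} : Filter F ->
  wlim F y z -> wlim F y' z' -> wlim F (fun i => y i - y' i) (z - z').
Proof.
move=> FF h h' f e e0; have e2 : 0 < e / 2 by rewrite divr_gt0.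
apply: filterS (filterI (h f _ e2) (h' f _ e2)) => i /= [].
rewrite (linearB (sval f) (y i)) (linearB (sval f) z) !ltr_distlC.
by move=> /andP[? ?] /andP[? ?]; apply/andP; split; lra.
Qed.

Lemma wlim_cst {R : realType} {X : normedModType R} {I : Type}
    {F : set_system I} (z : X) : Filter F -> wlim F (fun _ => z) z.
Proof.
by move=> FF f e e0; apply: filterS filterT => i _ /=; rewrite subrr normr0.
Qed.

Lemma ultra_bounded_lim {R : realType} {I : Type} {U : set_system I}
    {g : I -> R} {B : R} :
  UltraFilter U -> (forall i, `|g i| <= B) ->
  exists r, forall e, 0 < e -> U [set i | `|g i - r| < e].
Proof.
move=> UU gB; have := @segment_compact R (- B) B; rewrite compact_ultra.
move=> /(_ (g @ U) (fmap_ultra g UU)) [|r [_ gr]].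
  by apply: (@filterS _ U _ setT) filterT => i _ /=; rewrite in_itv /= -ler_norml.
exists r => e e0; apply: (gr [set u | `|u - r| < e]).
by apply/nbhs_ballP; exists e => //= x; rewrite /ball /= distrC.
Qed.

(** Hahn-Banach is applied to the increment [p (x + z) - p z]. The Lipschitz bound on [p] gives [f]
    norm at most 1, hence continuity. *)
Lemma convex_subgradient {R : realType} {X : normedModType R} {p : X -> R} :
  convex_fun p -> (forall x y, p x <= p y + `|x - y|) -> forall z,
  exists f : dual X, (forall x, p z + projT1 f (x - z) <= p x) /\
                     (forall x, `|projT1 f x| <= `|x|).
Proof.
move=> cp lp z; pose p' x := p (x + z) - p z.
have [||f fp] := @convex_hahn_banach R X p'.
- move=> t x y t0 t1; rewrite /p'.
  have -> : t *: x + (1 - t) *: y + z = t *: (x + z) + (1 - t) *: (y + z).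
    by rewrite !scalerDr addrACA -[t *: z + _]scalerDl subrKC scale1r.
  by have := cp t (x + z) (y + z) t0 t1; lra.
- by rewrite /p' add0r subrr.
have fle x : f x <= `|x|.
  apply: le_trans (fp x) _; have := lp (x + z) z; rewrite addrK /p'; lra.
have fn x : `|f x| <= `|x|.
  rewrite ler_norml fle andbT lerNl -(normrN x).
  by have := fle (- x); rewrite linearN.
have fc : continuous f.
  apply/linear_bounded_continuous/linear_boundedP; near=> M => x.
  by apply: le_trans (fn x) _; rewrite ler_peMl.
exists (exist _ f fc); split=> //= x.
by have := fp (x - z); rewrite /p' subrK; lra.
Unshelve. all: by end_near. Qed.

Lemma convex_fun_norm {R : realType} {X : normedModType R} (a : X) :
  convex_fun (fun x => `|x - a|).
Proof.
move=> t x y t0 t1.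
have -> : t *: x + (1 - t) *: y - a = t *: (x - a) + (1 - t) *: (y - a).
  by rewrite !scalerBr addrACA -opprD -[t *: a + _]scalerDl subrKC scale1r.
apply: le_trans (ler_normD _ _) _; rewrite !normrZ (ger0_norm t0).
by rewrite ger0_norm // subr_ge0.
Qed.

Lemma norm_sub_lip {R : realType} {X : normedModType R} (a x y : X) :
  `|x - a| <= `|y - a| + `|x - y|.
Proof.
have -> : x - a = (y - a) + (x - y) by rewrite [RHS]addrC addrA subrK.
exact: ler_normD.
Qed.

(** A subgradient of the norm at [z], tested at 0, takes at [z] a value no smaller than the norm of
    [z]. *)
Lemma norming_functional {R : realType} {X : normedModType R} (z : X) :
  exists f : dual X, projT1 f z = `|z| /\ forall x, `|projT1 f x| <= `|x|.
Proof.
have [f [fz fn]] := convex_subgradient (convex_fun_norm 0) (norm_sub_lip 0) z.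
exists f; split=> //; apply/eqP; rewrite eq_le.
rewrite (le_trans (ler_norm _) (fn z)) /=.
by have := fz 0; rewrite sub0r !subr0 linearN normr0; lra.
Qed.

(** Weak lower semicontinuity: the affine minorant given by a subgradient at [z] is weakly
    continuous and agrees with [p] at [z]. *)
Lemma wlim_convex_le {R : realType} {X : normedModType R} {I : Type}
    {F : set_system I} {y : I -> X} {z : X} {p : X -> R} {a : R} :
  ProperFilter F -> wlim F y z ->
  convex_fun p -> (forall x y, p x <= p y + `|x - y|) ->
  F [set i | p (y i) <= a] -> p z <= a.
Proof.
move=> FF yz cp lp Fa; have [f [fz _]] := convex_subgradient cp lp z.
apply/ler_addgt0Pr => e e0.
have [i /= []] := filter_ex (filterI Fa (yz f e e0)).
rewrite ltr_distlC => pa /andP[_ h].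
by have := fz (y i); rewrite linearB; move: pa h; lra.
Qed.

Lemma wlim_norm_le {R : realType} {X : normedModType R} {I : Type}
    {F : set_system I} {y : I -> X} {z : X} (b : X) {a : R} :
  ProperFilter F -> wlim F y z -> F [set i | `|y i - b| <= a] -> `|z - b| <= a.
Proof.
by move=> FF yz; exact: (wlim_convex_le FF yz (convex_fun_norm b) (norm_sub_lip b)).
Qed.

(* Gliding hump: the signs in [sum_n +-3^-n g_n] are chosen so that this
   functional is at least [n] in modulus at [x_n]. *)
Lemma weakly_compact_bounded {R : realType} {X : normedModType R} {C : set X} :
  weakly_compact C -> exists D : R, forall x, C x -> `|x| <= D.
Proof.
move=> Cwc; apply: contrapT => unb.
pose c (n : nat) : R := 3^-1 ^+ n.
have c0 n : 0 < c n by rewrite exprn_gt0 // invr_gt0.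
have cS n : 3 * c n.+1 = c n by rewrite /c exprS mulrA divff ?mul1r.
(* The factor 2 pays for the terms after the [n]-th, which cancel at most half of the hump at
   [x n]. *)
have /choice [x xP] : forall n, exists x, C x /\ 2 * n%:R <= c n * `|x|.
  move=> n; apply: contrapT => h; apply: unb; exists (2 * n%:R / c n) => x Cx.
  rewrite ler_pdivlMr // leNgt; apply/negP => lt; apply: h.
  by exists x; split=> //; rewrite [c n * _]mulrC ltW.
have /choice [g gP] : forall n, exists f : dual X,
    projT1 f (x n) = `|x n| /\ forall u, `|projT1 f u| <= `|u|.
  by move=> n; exact: norming_functional.
pose step (f : X -> R) n u := f u + c n * projT1 (g n) u.
pose step' (f : X -> R) n u := f u - c n * projT1 (g n) u.
pose f := fix f n : X -> R := if n is m.+1 then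
  if c m * `|x m| <= `|step (f m) m (x m)| then step (f m) m else step' (f m) m
  else fun _ => 0.
have fS m u : f m.+1 u = f m u + c m * projT1 (g m) u \/
              f m.+1 u = f m u - c m * projT1 (g m) u.
  by rewrite /=; case: ifP; [left|right].
have flin m l u v : f m (l *: u + v) = l * f m u + f m v.
  elim: m => [|m IH]; first by rewrite /= mulr0 addr0.
  rewrite /=; case: ifP => _; rewrite /step /step' IH linearP /=.
    by rewrite /GRing.scale /=; ring.
  by rewrite /GRing.scale /=; ring.
(* The two candidates differ by $2c_m\|x_m\|$ at [x m], so they cannot both be smaller than
   $c_m\|x_m\|$ in modulus. *)
have fbig m : c m * `|x m| <= `|f m.+1 (x m)|.
  rewrite /=; case: ifP => // /negbT; rewrite -ltNge /step /step'.
  rewrite (gP m).1 => h; have := mulr_ge0 (ltW (c0 m)) (normr_ge0 (x m)).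
  move: h; rewrite ltr_norml ler_normr => /andP[h1 h2] h3; apply/orP; right; lra.
have fstep m u : `|f m.+1 u - f m u| <= c m * `|u|.
  have h : `|c m * projT1 (g m) u| <= c m * `|u|.
    by rewrite normrM gtr0_norm // ler_pM2l // (gP m).2.
  by case: (fS m u) => ->; rewrite addrAC subrr add0r ?normrN.
(* The weights [c n.+1], ..., [c (n + j)] sum to half of [c n - c (n + j)]. *)
have fdist n j u :
    `|f (n.+1 + j)%N u - f n.+1 u| <= 2^-1 * (c n - c (n + j)%N) * `|u|.
  elim: j => [|j IH]; first by rewrite !addn0 !subrr normr0 mulr0 mul0r.
  rewrite !addnS; have := fstep (n.+1 + j)%N u; rewrite addSn.
  have := cS (n + j)%N; move: IH; rewrite addSn.
  set A := f _ u; set A' := f _ u; set A'' := f _ u => IH E h.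
  have -> : A'' - A' = (A'' - A) + (A - A') by ring.
  apply: le_trans (ler_normD _ _) _; rewrite -E in IH *.
  by move: IH h; lra.
have fB m u : `|f m u| <= 2 * `|u|.
  have := normr_ge0 u; case: m => [|m] nu; first by rewrite normr0 mulr_ge0.
  have -> : f m.+1 u = f (1 + m)%N u - f 1%N u + f 1%N u by rewrite subrK.
  apply: le_trans (ler_normD _ _) _; have := fdist 0%N m u.
  have := fstep 0%N u; rewrite subr0 add0n.
  have -> : c 0%N = 1 by [].
  have := mulr_ge0 (ltW (c0 m)) nu; lra.
have [U [UU oU]] := ultraFilterLemma eventually_filter.
have /choice [F FP] : forall u, exists r, forall e, 0 < e ->
    U [set m | `|f m u - r| < e].
  by move=> u; exact: (ultra_bounded_lim UU (fun m => fB m u)).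
have Fcvg u : (fun m => f m u) @ U --> F u.
  apply/cvgrPdist_lt => e e0; apply: filterS (FP u e e0) => m /=.
  by rewrite distrC.
have Flin : linear (F : X -> R^o).
  move=> l u v; suff -> : F (l *: u + v) = l * F u + F v by [].
  have h : f m (l *: u + v) @[m --> U] --> l * F u + F v.
    have -> : (fun m => f m (l *: u + v)) = (fun m => l * f m u + f m v).
      by apply/funext => m; exact: flin.
    by apply: cvgD; [apply: cvgM; [exact: cvg_cst|]|]; exact: Fcvg.
  exact: (cvg_unique _ (Fcvg _) h).
pose FL := HB.pack_for {linear X -> R^o} (F : X -> R^o)
  (GRing.isLinear.Build R X R^o *:%R F Flin).
have FB u : `|F u| <= 2 * `|u|.
  apply/ler_addgt0Pr => e e0; have [m /= h] := filter_ex (FP u e e0).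
  have := fB m u; move: h; rewrite -(ltrD2r `|f m u|) distrC => h fm.
  have := ler_normD (F u - f m u) (f m u); rewrite subrK; lra.
have Fc : continuous FL.
  apply/linear_bounded_continuous/linear_boundedP; near=> M => u.
  by apply: le_trans (FB u) _; rewrite ler_wpM2r.
have [z [_ xz]] := weakly_compact_wlim Cwc UU (fun n => (xP n).1).
have Flow n : n%:R <= `|F (x n)|.
  apply/ler_addgt0Pr => e e0.
  have Un : U [set m | (n.+1 <= m)%N] by apply: oU; exists n.+1.
  have [m /= [nm h]] := filter_ex (filterI Un (FP (x n) e e0)).
  have := fdist n (m - n.+1)%N (x n); rewrite subnKC // => h1.
  have h2 := fbig n; have [_ h3] := xP n.
  have h4 := mulr_ge0 (ltW (c0 (n + (m - n.+1))%N)) (normr_ge0 (x n)).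
  have h5 : `|f n.+1 (x n)| <= `|F (x n)| + e + `|f m (x n) - f n.+1 (x n)|.
    have {1}-> : f n.+1 (x n) = F (x n) + (f m (x n) - F (x n))
                                - (f m (x n) - f n.+1 (x n)) by ring.
    apply: le_trans (ler_normB _ _) _; rewrite lerD2r.
    by apply: le_trans (ler_normD _ _) _; rewrite lerD2l ltW.
  by move: h1 h2 h3 h4 h5; lra.
have Un : U [set m | (Num.trunc (`|F z| + 1)).+1 <= m]%N.
  by apply: oU; exists (Num.trunc (`|F z| + 1)).+1.
have := xz (exist _ FL Fc) 1 ltr01.
move=> /(filterI Un) /filter_ex [m /= [nm h]].
have h1 : `|F z| + 1 < m%:R.
  by apply: lt_le_trans (truncnS_gt _) _; rewrite ler_nat.
have h2 := Flow m.
have := ler_normD (F (x m) - F z) (F z); rewrite subrK.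
by move: h h1 h2; lra.
Unshelve. all: by end_near. Qed.

(** * Weakly convergent subsequences *)

Lemma filter_forall_leq {T : Type} {F : set_system T} {A : nat -> set T} k :
  Filter F -> (forall i, F (A i)) -> F [set t | forall i, (i <= k)%N -> A i t].
Proof.
move=> FF FA; elim: k => [|k IH].
  by apply: filterS (FA 0%N) => t At i; rewrite leqn0 => /eqP ->.
apply: filterS (filterI IH (FA k.+1)) => t [/= h At] i.
by rewrite leq_eqVlt => /predU1P[->//|]; rewrite ltnS; exact: h.
Qed.

(** [h k] is chosen beyond [k] in [S 0], ..., [S k], and [h] is iterated. The first conclusion
    indexes [S] by earlier terms, as pairwise distances require; the second by position, as limits
    require. *)
Lemma diagonal_selection {U : set_system nat} {S : nat -> set nat} :
  ProperFilter U -> \oo `<=` U -> (forall k, U (S k)) ->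
  exists n_ : nat -> nat,
    (forall i j, (i < j)%N -> (n_ i < n_ j)%N /\ S (n_ i) (n_ j)) /\
    (forall k j, (k < j)%N -> S k (n_ j)).
Proof.
move=> UU oU US.
have Ugt k : U [set m | (k < m)%N] by apply: oU; exists k.+1.
have /choice [h hP] : forall k, exists m, (k < m)%N /\
    forall i, (i <= k)%N -> S i m.
  move=> k; have [m [/= ? ?]] :=
    filter_ex (filterI (Ugt k) (filter_forall_leq k _ US)).
  by exists m.
pose n_ j := iter j.+1 h 0%N.
have nS j : n_ j.+1 = h (n_ j) by [].
have nlt j : (n_ j < n_ j.+1)%N by rewrite nS; have [] := hP (n_ j).
have nle i j : (i <= j)%N -> (n_ i <= n_ j)%N.
  elim: j => [|j IH]; first by rewrite leqn0 => /eqP ->.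
  rewrite leq_eqVlt => /predU1P[->//|]; rewrite ltnS => /IH ij.
  exact: leq_trans ij (ltnW (nlt j)).
have jn j : (j <= n_ j)%N by elim: j => // j IH; exact: leq_ltn_trans IH (nlt j).
exists n_; split=> [i [//|j]|k [//|j]]; rewrite ltnS => ij.
  split; first exact: leq_ltn_trans (nle _ _ ij) (nlt j).
  by rewrite nS; apply: (hP (n_ j)).2; exact: nle.
by rewrite nS; apply: (hP (n_ j)).2; exact: leq_trans ij (jn j).
Qed.

Lemma norm_small_eq0 {R : realType} {X : normedModType R} (x : X) :
  (forall e : R, 0 < e -> `|x| <= e) -> x = 0.
Proof.
move=> h; apply/eqP; rewrite -normr_le0; apply/ler_addgt0Pr => e e0.
by rewrite add0r; exact: h.
Qed.

(** [phi] is the distance to the range of [d]. Its convexity yields Mazur's theorem through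
    [wlim_convex_le]: weak limits of points of the range are approximated in norm by such points. *)
Lemma rational_span_approx {R : realType} {X : normedModType R} {J : Type}
    (d : J -> X) (j0 : J) :
  (forall p q, exists r, d r = d p + d q) ->
  (forall (a : rat) p, exists r, d r = ratr a *: d p) ->
  exists phi : X -> R,
    [/\ convex_fun phi, forall x y, phi x <= phi y + `|x - y|,
        forall p, phi (d p) <= 0
      & forall x e, phi x <= 0 -> 0 < e -> exists p, `|x - d p| < e].
Proof.
move=> dD dZ; pose phi x := inf (range (fun p => `|x - d p|)).
have has x : has_inf (range (fun p => `|x - d p|)).
  by split; [exists `|x - d j0|; exists j0|exists 0 => _ [p _ <-]].
have le x p : phi x <= `|x - d p| by apply: ge_inf; [exact: (has x).2|exists p].
have adh x e : 0 < e -> exists p, `|x - d p| < phi x + e.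
  by move=> e0; have [_ [p _ <-] h] := inf_adherent e0 (has x); exists p.
have ge0 x : 0 <= phi x by apply: lb_le_inf; [exact: (has x).1|move=> _ [p _ <-]].
have lip x y : phi x <= phi y + `|x - y|.
  apply/ler_addgt0Pr => e e0; have [p h] := adh y e e0.
  apply: le_trans (le x p) _; have := norm_sub_lip (d p) x y; lra.
have sub x y : phi (x + y) <= phi x + phi y.
  apply/ler_addgt0Pr => e e0; have e2 : 0 < e / 2 by rewrite divr_gt0.
  have [p hp] := adh x _ e2; have [q hq] := adh y _ e2.
  have [r rE] := dD p q; apply: le_trans (le _ r) _.
  rewrite rE opprD addrACA; apply: le_trans (ler_normD _ _) _; lra.
have scal t x : 0 <= t -> phi (t *: x) <= t * phi x.
  move=> t0; apply/ler_addgt0Pr => e e0.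
  pose M := phi x + `|x| + t + 1; have x0 := normr_ge0 x; have p0 := ge0 x.
  have M0 : 0 < M by rewrite /M; lra.
  pose e' := Num.min 1 (e / (2 * M)).
  have e'0 : 0 < e' by rewrite lt_min ltr01 divr_gt0 // mulr_gt0.
  have e'1 : e' <= 1 by rewrite ge_min lexx.
  have e'e : e' * (2 * M) <= e by rewrite -ler_pdivlMr ?mulr_gt0 // ge_min lexx orbT.
  have [a] : exists q : rat, ratr q \in `]t, t + e'[%R.
    by apply: rat_in_itvoo; rewrite ltrDl.
  rewrite in_itv /= => /andP[ta at'].
  have [p hp] := adh x e' e'0; have [r rE] := dZ a p.
  have h1 := lip (t *: x) (ratr a *: x).
  have h2 := le (ratr a *: x) r.
  rewrite rE -scalerBr normrZ gtr0_norm ?(le_lt_trans t0) // in h2.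
  rewrite -scalerBl normrZ distrC gtr0_norm ?subr_gt0 // in h1.
  have h3 : ratr a * `|x - d p| <= (t + e') * (phi x + e').
    have a0 := le_lt_trans t0 ta.
    by apply: ler_pM; rewrite ?normr_ge0 // ltW.
  have h4 : (ratr a - t) * `|x| <= e' * `|x|.
    by apply: ler_wpM2r => //; rewrite lerBlDl ltW.
  have h5 : e' * e' <= e' by rewrite ger_pMr.
  move: e'e; rewrite /M; nra.
exists phi; split=> //.
- move=> t x y t0 t1; apply: le_trans (sub _ _) _.
  by apply: lerD; apply: scal; rewrite ?subr_ge0.
- by move=> p; apply: le_trans (le _ p) _; rewrite subrr normr0.
- move=> x e px e0; have [p h] := adh x e e0; exists p.
  by apply: lt_le_trans h _; rewrite gerDr.
Qed.

(* Angelic property of weakly compact sets: countably many functionals norm the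
   rational span of the [y i - z], so they separate [z] from the other weak
   cluster points of the sequence. *)
Lemma wlim_subsequence {R : realType} {X : normedModType R} {C : set X}
    {U : set_system nat} {y : nat -> X} {z : X} :
  weakly_compact C -> (forall i, C (y i)) -> ProperFilter U -> wlim U y z ->
  exists B : nat -> set nat, (forall k, U (B k)) /\
    forall n_ : nat -> nat, (forall k j, (k < j)%N -> B k (n_ j)) ->
      wlim \oo (fun j => y (n_ j)) z.
Proof.
move=> Cwc Cy UU yz.
pose v i := y i - z.
(* Rational polynomials are a countable index for the finite rational combinations of the [v i]; the
   monomial ['X^i] stands for [v i]. *)
pose d (p : {poly rat}) : X := \sum_(i < size p) ratr p`_i *: v i.
have dE N (p : {poly rat}) : (size p <= N)%N -> d p = \sum_(i < N) ratr p`_i *: v i.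
  move=> pN; rewrite /d (big_ord_widen N (fun i => ratr p`_i *: v i)) // big_mkcond.
  apply: eq_bigr => i _; case: ltnP => // h.
  by rewrite nth_default // raddf0 scale0r.
have dD (p q : {poly rat}) : exists r, d r = d p + d q.
  exists (p + q); pose N := maxn (size p) (size q).
  rewrite (dE N (p + q)) ?size_polyD // (dE N p) ?leq_maxl // (dE N q) ?leq_maxr //.
  rewrite -big_split /=; apply: eq_bigr => i _.
  by rewrite coefD rmorphD /= scalerDl.
have dZ (a : rat) (p : {poly rat}) : exists r, d r = ratr a *: d p.
  exists (a *: p); rewrite (dE (size p) (a *: p)) ?size_scale_leq // scaler_sumr.
  by apply: eq_bigr => i _; rewrite coefZ rmorphM /= scalerA.
have dX i : d 'X^i = v i.
  rewrite /d size_polyXn big_ord_recr /= coefXn eqxx rmorph1 scale1r.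
  rewrite big1 ?add0r // => j _.
  by rewrite coefXn ltn_eqF ?ltn_ord // rmorph0 scale0r.
have [phi [cphi lphi phi0 phiapp]] := rational_span_approx d 0 dD dZ.
have /choice [g gP] : forall p, exists f : dual X,
    projT1 f (d p) = `|d p| /\ forall u, `|projT1 f u| <= `|u|.
  by move=> p; exact: norming_functional.
pose h i := g (odflt 0 (unpickle i)).
pose B k := [set n | forall i, (i <= k)%N ->
  `|projT1 (h i) (y n) - projT1 (h i) z| < k.+1%:R^-1].
exists B; split=> [k|n_ nB].
  by apply: filter_forall_leq => i; apply: yz; rewrite invr_gt0.
move=> f e e0; apply: contrapT => nev.
(* If convergence fails at [f], an ultrafilter concentrated on the bad indices gives a weak limit
   [z']. The contradiction comes from proving [z' = z]. *)
pose bad := [set j | ~ (`|projT1 f (y (n_ j)) - projT1 f z| < e)].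
have pr : ProperFilter (within bad \oo).
  apply: Build_ProperFilter_ex => P /= wP; apply: contrapT => nP.
  apply: nev; move: wP; rewrite /within /=; apply: filterS => j Pj.
  apply: contrapT => bj.
  by apply: nP; exists j; exact: Pj.
have [V [VU wV]] := ultraFilterLemma pr.
have oV : \oo `<=` V.
  by move=> A oA; apply: wV; rewrite /within /=; apply: filterS oA => j Aj _.
have Vbad : V bad by apply: wV; rewrite /within /=; apply: filterS filterT.
have [z' [_ yz']] := weakly_compact_wlim Cwc VU (fun j => Cy (n_ j)).
have gz' p : projT1 (g p) z' = projT1 (g p) z :> R.
  apply/subr0_eq/norm_small_eq0 => e' e'0.
  have e2 : 0 < e' / 2 by rewrite divr_gt0.
  pose k := maxn (pickle p) (Num.trunc (e' / 2)^-1).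
  have ke : k.+1%:R^-1 <= e' / 2.
    rewrite -[leRHS]invrK lef_pV2 ?posrE ?invr_gt0 //.
    apply: ltW; apply: lt_le_trans (truncnS_gt _) _.
    by rewrite ler_nat ltnS leq_maxr.
  have pk : (pickle p <= k)%N by exact: leq_maxl.
  move: k ke pk => k ke pk.
  have Vk : V [set j | (k < j)%N] by apply: oV; exists k.+1.
  have [j [/= kj]] := filter_ex (filterI Vk (yz' (g p) _ e2)).
  have := nB k j kj (pickle p) pk; rewrite /h pickleK /=.
  move=> /lt_le_trans /(_ ke) lt1 lt2.
  rewrite -(subrKA (projT1 (g p) (y (n_ j)))) (splitr e').
  apply: le_trans (ler_normD _ _) _; apply: lerD; last exact: ltW.
  by rewrite distrC ltW.
have phiw : phi (z' - z) <= 0.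
  apply: (wlim_convex_le _ (wlimB _ yz' (wlim_cst z _)) cphi lphi).
  by apply: filterS filterT => j _ /=; rewrite -[_ - _]dX.
(* [g p] vanishes at [z' - z] but norms [d p]; when [d p] is close to [z' - z], both are therefore
   small. *)
have zz' : z' = z.
  apply/subr0_eq/norm_small_eq0 => e' e'0.
  have e2 : 0 < e' / 2 by rewrite divr_gt0.
  have [p hp] := phiapp _ _ phiw e2.
  have [gd gn] := gP p; have := gn (d p - (z' - z)).
  rewrite (linearB (sval (g p)) (d p)) (linearB (sval (g p)) z').
  rewrite gz' subrr subr0 gd normr_id distrC => hd.
  have := ler_normD (z' - z - d p) (d p); rewrite subrK; lra.
have [j [/= bj]] := filter_ex (filterI Vbad (yz' f e e0)).
by rewrite zz'.
Qed.

(** * The two geometric moduli *)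

Lemma limn_einf_ge {R : realType} {g : nat -> R} {a : R} :
  \oo [set n | a <= g n] -> (a%:E <= limn_einf (fun n => (g n)%:E))%E.
Proof.
move=> ag; rewrite -[limn_einf _]/(limf_einf (fun n => (g n)%:E) \oo) limf_einfE.
apply: le_ereal_sup_tmp; eexists; first by exists [set n | a <= g n].
by apply/ereal_infP => _ [n /= agn <-]; rewrite lee_fin.
Qed.

Lemma limn_esup_le {R : realType} {g : nat -> R} {b : R} :
  \oo [set n | g n <= b] -> (limn_esup (fun n => (g n)%:E) <= b%:E)%E.
Proof.
move=> gb; rewrite /limn_esup /limf_esup.
apply: ge_ereal_inf; eexists; first by exists [set n | g n <= b].
by apply/ereal_supP => _ [n /= gnb <-]; rewrite lee_fin.
Qed.

Lemma limn_esup_ge {R : realType} {g : nat -> R} {a : R} :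
  (forall e V, 0 < e -> \oo V -> exists n, V n /\ a - e <= g n) ->
  (a%:E <= limn_esup (fun n => (g n)%:E))%E.
Proof.
move=> h; rewrite /limn_esup /limf_esup; apply/ereal_infP => _ [V oV <-].
apply/lee_addgt0Pr => e e0; have [n [Vn ag]] := h e V e0 oV.
rewrite -leeBlDr //; apply: le_ereal_sup_tmp; exists (g n)%:E; first by exists n.
by rewrite -EFinB lee_fin.
Qed.

Lemma closure_conv_hull_ge {R : realType} {X : normedModType R} (f : dual X)
    (a : R) (x : nat -> X) : (forall u, `|projT1 f u| <= `|u|) ->
  (forall n, a <= projT1 f (x n)) ->
  forall v, closure (conv_hull (range x)) v -> a <= projT1 f v.
Proof.
move=> fn fx v clv; apply/ler_addgt0Pr => e e0.
have [w [hw vw]] := clv (ball v e) (nbhsx_ballx v e e0).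
have aw : a <= projT1 f w.
  apply: (@smallest_sub X (@convex_set R X) (range x)
    [set v | a <= projT1 f v] _ _ w hw).
  - move=> s t l; rewrite !inE /= => fs ft.
    have -> : conv l s t = l%:num *: (s : X) + (1 - l%:num) *: (t : X) by [].
    have l0 : 0 <= (l%:num : R) by rewrite ge0.
    have l1 : (l%:num : R) <= 1 by rewrite le1.
    by rewrite linearD !linearZ /= /GRing.scale /=; nra.
  - by move=> _ [n _ <-]; exact: fx.
have := le_trans (ler_norm _) (fn (w - v)).
rewrite -ball_normE /= in vw; rewrite linearB -(distrC v); lra.
Qed.

(* [v |-> lim_U `|u j - v|] is convex, so it has a subgradient [f] at [0]; as
   [f (u j)] tends to [0], [f] is small on the convex hulls of late tails. *)
Lemma asymp_radius_tail_ge {R : realType} {X : normedModType R} {u : nat -> X}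
    {M r e : R} :
  wlim \oo u 0 -> (forall j, `|u j| <= M) -> 0 < e ->
  (forall e, 0 < e -> \oo [set j | `| `|u j| - r | < e]) ->
  \forall m \near \oo, ((r - e)%:E <= asymp_radius (fun j => u (m + j)%N))%E.
Proof.
move=> u0 uM e0 ur.
have [U [UU oU]] := ultraFilterLemma eventually_filter.
have /choice [phi phiP] : forall v, exists s, forall e, 0 < e ->
    U [set j | `| `|u j - v| - s | < e].
  move=> v; apply: (@ultra_bounded_lim _ _ _ _ (M + `|v|) UU) => j.
  by rewrite normr_id (le_trans (ler_normB _ _)) // lerD2r.
have phi0 : phi 0 = r.
  apply/subr0_eq/(@norm_small_eq0 _ R^o) => d d0.
  have d2 : 0 < d / 2 by rewrite divr_gt0.
  have [j [/=]] := filter_ex (filterI (phiP 0 _ d2) (oU _ (ur _ d2))).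
  rewrite subr0 !ltr_distlC ler_norml => /andP[? ?] /andP[? ?].
  by apply/andP; split; lra.
have phil x y : phi x <= phi y + `|x - y|.
  apply/ler_addgt0Pr => d d0; have d2 : 0 < d / 2 by rewrite divr_gt0.
  have [j [/=]] := filter_ex (filterI (phiP x _ d2) (phiP y _ d2)).
  rewrite !ltr_distlC => /andP[? ?] /andP[? ?].
  by have := norm_sub_lip (u j) x y; rewrite !(distrC _ (u j)); lra.
have phic : convex_fun phi.
  move=> t x y t0 t1; set w := t *: x + _.
  apply/ler_addgt0Pr => d d0; have d2 : 0 < d / 2 by rewrite divr_gt0.
  have [j [[/=]]] := filter_ex
    (filterI (filterI (phiP x _ d2) (phiP y _ d2)) (phiP w _ d2)).
  rewrite !ltr_distlC => /andP[? ?] /andP[? ?] /andP[? ?].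
  have := convex_fun_norm (u j) t x y t0 t1; rewrite -/w !(distrC _ (u j)); nra.
have [f [fphi fn]] := convex_subgradient phic phil 0.
have := u0 f e e0; rewrite linear0 => -[m0 _ hm].
exists m0 => // m /= m0m.
apply/ereal_infP => _ [v clv <-]; apply: limn_esup_ge => d V d0 [N _ NV].
have fv : - e <= projT1 f v.
  apply: closure_conv_hull_ge clv => // n.
  have /hm : (m0 <= m + n)%N by exact: leq_trans m0m (leq_addr _ _).
  by rewrite /= subr0 ltr_norml => /andP[/ltW].
(* [U] lives on the indices of [u]; the term [u j] has index [j - m] in the tail, and this index
   must reach [N]. *)
have UN : U [set j | (m + N <= j)%N] by apply: oU; exists (m + N)%N.
have [j [/= mj]] := filter_ex (filterI UN (phiP v d d0)).
rewrite ltr_distlC => /andP[_ hj].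
have Nj : (N <= j - m)%N by rewrite leq_subRL // (leq_trans (leq_addr _ _) mj).
exists (j - m)%N; split; first exact: NV.
rewrite subnKC ?(leq_trans (leq_addr _ _) mj) //.
by have := fphi v; rewrite subr0 phi0; move: hj fv; lra.
Qed.

(** Centres other than 0 may give a smaller radius; passing to a late tail makes this gain
    arbitrarily small. *)
Lemma WCS_le {R : realType} {X : normedModType R} {u : nat -> X}
    {k M r b : R} :
  0 <= k -> k < WCS X -> wlim \oo u 0 -> (forall j, `|u j| <= M) ->
  (forall e, 0 < e -> \oo [set j | `| `|u j| - r | < e]) ->
  (forall e, 0 < e -> \forall N \near \oo,
    forall i j, (N <= i)%N -> (N <= j)%N -> `|u i - u j| <= b + e) ->
  k * r <= b.
Proof.
move=> k0 kW u0 uM ur ub.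
have b0 : 0 <= b.
  apply/ler_addgt0Pr => e e0; have [N h] := filter_ex (ub e e0).
  by have := h N N (leqnn _) (leqnn _); rewrite subrr normr0.
have u0' : weakly_cvg u 0 by apply/weakly_cvgP.
move: kW; rewrite /WCS; case: asboolP => [/(_ _ _ u0') /cvgrPdist_lt us _|_].
  suff r0 : r <= 0 by nra.
  apply/ler_addgt0Pr => e e0; have e2 : 0 < e / 2 by rewrite divr_gt0.
  have [j [/=]] := filter_ex (filterI (us _ e2) (ur _ e2)).
  by rewrite sub0r normrN ltr_distlC => ? /andP[? ?]; lra.
set K := [set _ | _] => kK.
(* A set without a supremum has [sup] equal to 0, which [0 <= k < sup K] rules out. *)
have hK : has_sup K.
  by apply: contrapT => /sup_out; move: kK => /[swap] ->; rewrite ltNge k0.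
have [k' Kk' kk'] : exists2 k', K k' & k < k'.
  have e0 : 0 < sup K - k by rewrite subr_gt0.
  by have [k' ? ?] := sup_adherent e0 hK; exists k' => //; lra.
have r0 : 0 <= r.
  apply/ler_addgt0Pr => e e0; have [j /=] := filter_ex (ur e e0).
  by rewrite ltr_distlC => /andP[h _]; have := normr_ge0 (u j); lra.
suff : k' * r <= b by nra.
apply/ler_addgt0Pr => e e0; pose d := e / (1 + k').
have d0 : 0 < d by rewrite divr_gt0 //; lra.
have [m [/= hr hd]] := filter_ex
  (filterI (asymp_radius_tail_ge u0 uM d0 ur) (ub d d0)).
pose v j := u (m + j)%N.
have v0 : weakly_null v.
  apply/weakly_cvgP => f c c0; have [N _ h] := u0 f c c0.
  exists N => // j /= Nj; apply: h => /=; exact: leq_trans Nj (leq_addl _ _).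
have vd : (asymp_diam v <= (b + d)%:E)%E.
  apply: ge_ereal_inf; eexists; first by exists 0%N.
  apply/ereal_supP => _ [i _] [j _] <-; rewrite lee_fin.
  by apply: hd; exact: leq_addr.
have k'0 : (0 <= k'%:E)%E by rewrite lee_fin; lra.
have := le_trans (le_trans (lee_wpmul2l k'0 hr) (Kk' v v0)) vd.
rewrite -EFinM lee_fin.
have -> : e = d * (1 + k') by rewrite /d divfK // gt_eqF //; lra.
lra.
Qed.

(** Division by [r] normalizes [u] and [v] as in the definition of the modulus, which is then at
    most [b / r - 1]. *)
Lemma opial_modulus_le {R : realType} {X : normedModType R} {u : nat -> X}
    {v : X} {k r b : R} :
  0 < r -> (k%:E < 1 + opial_modulus X 1)%E -> wlim \oo u 0 -> r <= `|v| ->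
  \oo [set j | r <= `|u j|] -> \oo [set j | `|u j + v| <= b] -> k * r <= b.
Proof.
move=> r0 kop u0 rv ru ub; pose x j := r^-1 *: u j; pose y := r^-1 *: v.
have nr w : `|r^-1 *: w| = `|w| / r.
  by rewrite normrZ gtr0_norm ?invr_gt0 // mulrC.
have x0 : weakly_null x.
  apply/weakly_cvgP => f e e0; have er : 0 < e * r by rewrite mulr_gt0.
  apply: filterS (u0 f _ er) => j /=.
  rewrite linear0 !subr0 linearZ /= normrM gtr0_norm ?invr_gt0 // => h.
  by rewrite mulrC ltr_pdivrMr.
have x1 : (1 <= limn_einf (fun n => `|x n|%:E))%E.
  apply: limn_einf_ge; apply: filterS ru => j /= h.
  by rewrite nr ler_pdivlMr // mul1r.
have y1 : 1 <= `|y| by rewrite nr ler_pdivlMr // mul1r.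
have xy : (limn_einf (fun n => `|x n + y|%:E) <= (b / r)%:E)%E.
  apply: le_trans (limn_einf_sup _) _; apply: limn_esup_le.
  apply: filterS ub => j /= h.
  by rewrite /x /y -scalerDr nr ler_pM2r ?invr_gt0.
have op : (opial_modulus X 1 <= (b / r)%:E - 1)%E.
  apply: ge_ereal_inf; eexists; first by exists x => //; exists y.
  by rewrite leeD2r.
have : (k%:E < (b / r)%:E)%E.
  apply: lt_le_trans kop _; apply: le_trans (leeD2l _ op) _.
  by rewrite -EFinB -EFinD addrC subrK.
by rewrite lte_fin => /ltW; rewrite ler_pdivlMr.
Qed.

(** * Asymptotic centers of orbits *)

Lemma near_invS_le {R : realType} {e : R} :
  0 < e -> \forall i \near \oo, i.+1%:R^-1 <= e.
Proof.
move=> e0; have := near_infty_natSinv_lt (PosNum e0).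
by apply: filterS => i; exact: ltW.
Qed.

Section AsymptoticCenters.
Context {R : realType} {X : normedModType R} {C : set X} {S : nat -> X -> X}
  {s : R} {U : set_system nat}.
Hypothesis Cwc : weakly_compact C.
Hypothesis s0 : 0 <= s.
Hypothesis SC : forall n x, C x -> C (S n x).
Hypothesis SL : forall n x y, C x -> C y -> `|S n x - S n y| <= s * `|x - y|.
Hypothesis Sreg : forall m x (e : R), C x -> 0 < e ->
  \oo [set n | `|S m (S n x) - S n x| < e].
Hypothesis UU : UltraFilter U.
Hypothesis oU : \oo `<=` U.

(** [S i w] is within [s * a] of [S i (S n x)], and asymptotic regularity brings the latter close to
    [S n x]. *)
Lemma orbit_dist_le i {x w : X} {a e : R} : C x -> C w -> 0 < e ->
  U [set n | `|w - S n x| <= a] -> U [set n | `|S n x - S i w| <= s * a + e].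
Proof.
move=> Cx Cw e0 Ua; have Ur := oU _ (Sreg i x e Cx e0).
apply: filterS (filterI Ua Ur) => n /= [h1 h2].
have h3 := SL i w (S n x) Cw (SC n x Cx).
rewrite -(subrKA (S i (S n x))); apply: le_trans (ler_normD _ _) _.
rewrite distrC in h2; rewrite distrC in h3.
by have := ler_wpM2l s0 h1; lra.
Qed.

(** The moduli concern sequences along [\oo]. Intersecting three families of members of [U] lets one
    diagonal subsequence inherit the weak limit, the limiting distance [r] and the sets [A]. *)
Lemma wlim_subsequence_selection {x z : X} {r : R} {A : nat -> set nat} :
  C x -> wlim U (fun n => S n x) z ->
  (forall e, 0 < e -> U [set n | `| `|S n x - z| - r | < e]) ->
  (forall k, U (A k)) ->
  exists n_ : nat -> nat,
    [/\ forall i j, (i < j)%N -> (i <= n_ i)%N /\ A (n_ i) (n_ j),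
        forall k j, (k < j)%N -> A k (n_ j),
        wlim \oo (fun j => S (n_ j) x - z) 0
      & forall e, 0 < e -> \oo [set j | `| `|S (n_ j) x - z| - r | < e] ].
Proof.
move=> Cx xz Ur UA.
have [B [UB Bw]] := wlim_subsequence Cwc (fun n => SC n x Cx) _ xz.
pose A' k := A k `&` B k `&` [set n | `| `|S n x - z| - r | < k.+1%:R^-1].
have UA' k : U (A' k).
  by apply: filterI; [exact: filterI|apply: Ur; rewrite invr_gt0].
have [n_ [nlt nA]] := diagonal_selection _ oU UA'.
have jn j : (j <= n_ j)%N.
  by elim: j => // j IH; apply: leq_ltn_trans IH (nlt _ _ (ltnSn j)).1.
exists n_; split=> [i j ij|k j kj||e e0].
- by split=> //; have [_ [[]]] := nlt i j ij.
- by have [[]] := nA k j kj.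
- have {}Bw := Bw n_ (fun k j kj => (nA k j kj).1.2).
  by have := wlimB _ Bw (wlim_cst z _); rewrite subrr; exact.
- have [N _ hN] := near_invS_le e0; exists N.+1 => // j /= Nj.
  by apply: lt_le_trans (nA N j Nj).2 (hN N _); rewrite /=.
Qed.

Lemma center_dist_exists {x z : X} : C x -> exists r,
  0 <= r /\ forall e, 0 < e -> U [set n | `| `|S n x - z| - r | < e].
Proof.
move=> Cx; have [D hD] := weakly_compact_bounded Cwc.
have [r hr] : exists r, forall e, 0 < e -> U [set n | `| `|S n x - z| - r | < e].
  apply: (@ultra_bounded_lim _ _ _ _ (D + `|z|) UU) => n.
  by rewrite normr_id (le_trans (ler_normB _ _)) // lerD2r hD //; exact: SC.
exists r; split=> //; apply/ler_addgt0Pr => e e0.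
have [n /=] := filter_ex (hr e e0); rewrite ltr_distlC => /andP[h _].
by have := normr_ge0 (S n x - z); lra.
Qed.

Lemma center_orbit_near m {x z : X} {r e : R} : C x -> C z -> 0 < e ->
  (forall e, 0 < e -> U [set n | `| `|S n x - z| - r | < e]) ->
  U [set n | `|S n x - S m z| <= s * r + e].
Proof.
move=> Cx Cz e0 Ur; pose d := e / (s + 1).
have d0 : 0 < d by rewrite divr_gt0 //; move: s0; lra.
have := @orbit_dist_le m x z (r + d) d Cx Cz d0.
have -> : s * (r + d) + d = s * r + e.
  have <- : d * (s + 1) = e by rewrite divfK // gt_eqF //; move: s0; lra.
  by ring.
apply; apply: filterS (Ur d d0) => n /=.
by rewrite (distrC z) ltr_distlC => /andP[h _]; move: h; lra.
Qed.

(** Along [U] the orbit stays within nearly [s * r] of [S m z], and closed balls are weakly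
    closed. *)
Lemma center_defect_le m {x z : X} {r : R} : C x -> C z ->
  wlim U (fun n => S n x) z ->
  (forall e, 0 < e -> U [set n | `| `|S n x - z| - r | < e]) ->
  `|z - S m z| <= s * r.
Proof.
move=> Cx Cz xz Ur; apply/ler_addgt0Pr => e e0.
by apply: wlim_norm_le xz _; exact: center_orbit_near.
Qed.

Lemma defect_contraction_WCS {k : R} m {x z : X} {a : R} :
  0 <= k -> k < WCS X -> C x -> C z -> wlim U (fun n => S n x) z ->
  U [set n | `|x - S n x| <= a] -> k * `|z - S m z| <= s * s * a.
Proof.
move=> k0 kW Cx Cz xz Ua; have [D hD] := weakly_compact_bounded Cwc.
have [r [r0 Ur]] := center_dist_exists (z := z) Cx.
pose A i := [set n | `|S n x - S i x| <= s * a + i.+1%:R^-1].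
have UA i : U (A i) by apply: orbit_dist_le => //; rewrite invr_gt0.
have [n_ [nA _ nw nr]] := wlim_subsequence_selection Cx xz Ur UA.
have kr : k * r <= s * a.
  apply: (WCS_le (M := D + `|z|) k0 kW nw _ nr) => [j|e e0].
    by rewrite (le_trans (ler_normB _ _)) // lerD2r hD //; exact: SC.
  have [N _ hN] := near_invS_le e0; exists N => // N' /= NN' i j iN jN.
  (* The pair condition bounds the error by the reciprocal of [(n_ i').+1], which is small because
     [i' <= n_ i']. *)
  have lt i' j' : (N' <= i')%N -> (i' < j')%N ->
      `|S (n_ j') x - S (n_ i') x| <= s * a + e.
    move=> i'N i'j'; have [i'n Aij] := nA i' j' i'j'.
    apply: le_trans Aij _; rewrite lerD2l; apply: hN => /=.
    exact: leq_trans NN' (leq_trans i'N i'n).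
  rewrite opprB addrA subrK; case: (ltngtP i j) => [ij|ji|->].
  - by rewrite distrC; exact: lt.
  - exact: lt.
  - by rewrite subrr normr0 (le_trans (normr_ge0 _) (lt j j.+1 jN _)).
have := center_defect_le m Cx Cz xz Ur.
move=> /(ler_wpM2l k0) h; apply: le_trans h _.
by rewrite mulrCA -mulrA; exact: ler_wpM2l.
Qed.

Lemma defect_contraction_opial {k : R} m {x z : X} {a : R} :
  s < k -> (k%:E < 1 + opial_modulus X 1)%E ->
  C x -> C z -> wlim U (fun n => S n x) z -> 0 <= a ->
  U [set n | `|x - S n x| <= a] -> k * `|z - S m z| <= s * a.
Proof.
move=> sk kop Cx Cz xz a0 Ua; have k0 : 0 < k by exact: le_lt_trans s0 sk.
have [r [r0 Ur]] := center_dist_exists (z := z) Cx.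
have zr := center_defect_le m Cx Cz xz Ur.
(* The Opial estimate divides by the radius, so a vanishing [r] is treated apart. *)
have [r00|r_gt0] := leP r 0.
  have z0 := normr_ge0 (z - S m z).
  have -> : `|z - S m z| = 0.
    by apply/eqP; rewrite eq_le z0 andbT; move: s0 zr r00 r0; nra.
  by rewrite mulr0 mulr_ge0.
pose A i := [set n | `|S n x - S i x| <= s * a + i.+1%:R^-1] `&`
            [set n | `|S n x - S m z| <= s * r + i.+1%:R^-1].
have UA i : U (A i).
  by apply: filterI; [apply: orbit_dist_le|apply: center_orbit_near];
    rewrite ?invr_gt0.
have [n_ [_ nA nw nr]] := wlim_subsequence_selection Cx xz Ur UA.
(* The Opial modulus, applied to translates by [z - w] of the centred orbit. *)
have op w b e : 0 < e -> r - e <= `|z - w| ->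
    \oo [set j | `|S (n_ j) x - w| <= b] -> 0 <= b -> k * r <= b + k * e.
  move=> e0 rw ub b0; have [re|re] := leP r e.
    by have := ler_wpM2l (ltW k0) re; lra.
  have : k * (r - e) <= b.
    apply: (opial_modulus_le _ kop nw rw); first by rewrite subr_gt0.
      apply: filterS (nr e e0) => j /=; rewrite ltr_distlC => /andP[_ h].
      by move: h; lra.
    by apply: filterS ub => j /=; rewrite addrA subrK.
  by rewrite mulrBr; lra.
have kr : k * r <= s * a.
  apply/ler_addgt0Pr => e e0; pose d := e / (1 + k).
  have d0 : 0 < d by rewrite divr_gt0 //; lra.
  (* The translate is taken at an orbit point [S i x], whose distance to [z] exceeds [r - d] and
     whose error term is at most [d]. *)
  have [i [/= hi id]] := filter_ex (filterI (Ur d d0) (oU _ (near_invS_le d0))).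
  have := op (S i x) (s * a + d) d d0.
  have -> : s * a + d + k * d = s * a + e.
    have <- : d * (1 + k) = e by rewrite divfK // gt_eqF //; lra.
    by ring.
  apply.
  - by move: hi; rewrite ltr_distlC (distrC (S i x)) => /andP[_ ?]; lra.
  - exists i.+1 => // j /= ij; have [/= h _] := nA i j ij.
    by apply: le_trans h _; rewrite lerD2l.
  - by apply: addr_ge0; [exact: mulr_ge0|exact: ltW].
suff : `|z - S m z| <= r by move=> /(ler_wpM2l (ltW k0)) h; exact: le_trans h kr.
(* If [S m z] were farther than [r] from [z], it could serve as [w] in [op], giving [k * r <= s * r]
   against [s < k]. *)
rewrite leNgt; apply/negP => rz; suff : k * r <= s * r by rewrite leNgt ltr_pM2r ?sk.
apply/ler_addgt0Pr => e e0; pose d := e / (1 + k).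
have d0 : 0 < d by rewrite divr_gt0 //; lra.
have := op (S m z) (s * r + d) d d0.
have -> : s * r + d + k * d = s * r + e.
  have <- : d * (1 + k) = e by rewrite divfK // gt_eqF //; lra.
  by ring.
apply; first by move: rz d0; lra.
  have [N _ hN] := near_invS_le d0; exists N.+1 => // j /= Nj.
  have [_ /= h] := nA N j Nj; apply: le_trans h _.
  by rewrite lerD2l; apply: hN => /=.
by apply: addr_ge0; [exact: mulr_ge0|exact: ltW].
Qed.

End AsymptoticCenters.

(** * The retraction *)

Lemma expr_lt_small {R : realType} {q e : R} :
  0 < q -> q < 1 -> 0 < e -> exists k : nat, q ^+ k < e.
Proof.
move=> q0 q1 e0.
have /cvgrPdist_lt /(_ e e0) [k _ h] : q ^+ n @[n --> \oo] --> 0.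
  by apply: cvg_expr; rewrite gtr0_norm.
exists k; have := h k (leqnn k).
by rewrite /= sub0r normrN gtr0_norm // exprn_gt0.
Qed.

Lemma geometric_limit {R : realType} {X : completeNormedModType R}
    {x : nat -> X} {B q : R} :
  0 <= B -> 0 < q -> q < 1 -> (forall k, `|x k.+1 - x k| <= B * q ^+ k) ->
  exists l, forall k, `|l - x k| <= B / (1 - q) * q ^+ k.
Proof.
move=> B0 q0 q1 xq; pose A := B / (1 - q).
have q1' : 0 < 1 - q by rewrite subr_gt0.
have A0 : 0 <= A by rewrite divr_ge0 // ltW.
have BA : B = A * (1 - q) by rewrite divfK // gt_eqF.
have tele k j : `|x (k + j)%N - x k| <= A * (q ^+ k - q ^+ (k + j)).
  elim: j => [|j IH]; first by rewrite addn0 !subrr normr0 mulr0.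
  rewrite addnS -(subrKA (x (k + j)%N)); apply: le_trans (ler_normD _ _) _.
  have := xq (k + j)%N; rewrite exprS BA; move: IH; lra.
have qk k : 0 < q ^+ k by exact: exprn_gt0.
have tail k m : (k <= m)%N -> `|x m - x k| <= A * q ^+ k.
  move=> km; have := tele k (m - k)%N; rewrite subnKC // => h.
  by apply: le_trans h _; rewrite ler_wpM2l // lerBlDr lerDl ltW.
have cx : cvg (x @ \oo).
  apply/cauchy_cvgP/cauchy_exP => e e0.
  have [k hk] := expr_lt_small q0 q1 (divr_gt0 e0 (ltr_wpDl A0 ltr01)).
  exists (x k); exists k => // m /= km; rewrite -ball_normE /= distrC.
  apply: le_lt_trans (tail k m km) _; rewrite ltr_pdivlMr in hk.
    by apply: le_lt_trans hk; rewrite mulrDr mulr1 mulrC lerDl ltW.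
  exact: ltr_wpDl.
exists (lim (x @ \oo)) => k; apply/ler_addgt0Pr => e e0.
have [N _ hN] := (cvgrPdist_lt _ _).1 cx e e0.
have /= h1 := hN (maxn N k) (leq_maxl _ _).
have h2 := tail k (maxn N k) (leq_maxr _ _).
rewrite -(subrKA (x (maxn N k))); apply: le_trans (ler_normD _ _) _.
by rewrite addrC lerD // ltW.
Qed.

(* Choosing [k] with [(q / M) ^ k ~ d / D] balances the two terms; the exponent
   [a] is the one for which [(q / M) `^ a = q]. *)
Lemma holder_interpolation {R : realType} {q M B D : R} :
  0 < q -> q < 1 -> 1 <= M -> 0 <= B -> 0 < D ->
  exists K a : R, [/\ 0 < K, 0 < a, a <= 1 & forall g d, 0 <= d -> d <= D ->
    (forall k, g <= M ^+ k * d + B * q ^+ k) -> g <= K * d `^ a].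
Proof.
move=> q0 q1 M1 B0 D0; have M0 : 0 < M by exact: lt_le_trans M1.
pose t := q / M; have t0 : 0 < t by rewrite divr_gt0.
have tq : t <= q by rewrite ler_pdivrMr // ler_peMr // ltW.
have t1 : t < 1 by exact: le_lt_trans q1.
have lq : ln q < 0 by rewrite ln_lt0 // q0.
have lt : ln t < 0 by rewrite ln_lt0 // t0.
have ltq : ln t <= ln q by rewrite ler_ln.
pose a := ln q / ln t.
have a0 : 0 < a by rewrite /a -[X in 0 < X]mulrNN -invrN divr_gt0 // oppr_gt0.
have a1 : a <= 1 by rewrite /a ler_ndivrMr // mul1r.
have ta : t `^ a = q.
  by rewrite /powR gt_eqF // divfK ?lt_eqF // lnK // posrE.
(* Dividing by [q] pays for passing from [q ^+ k] to [q ^+ k.+1]; the power of [D^-1] rescales [d]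
   to [u = d / D <= 1]. *)
exists ((D + B) / q * D^-1 `^ a), a; split => //.
  by rewrite mulr_gt0 ?divr_gt0 ?powR_gt0 ?invr_gt0 //; lra.
move=> g d d0 dD hg.
have [dz|dn0] := eqVneq d 0.
  rewrite dz powR0 ?gt_eqF // mulr0; apply/ler_addgt0Pr => e e0; rewrite add0r.
  have [k hk] := expr_lt_small q0 q1 (divr_gt0 e0 (ltr_wpDl B0 ltr01)).
  have := hg k; rewrite dz mulr0 add0r => h; apply: le_trans h _.
  rewrite ltr_pdivlMr in hk; last exact: ltr_wpDl.
  apply: ltW; apply: le_lt_trans hk.
  by rewrite mulrDr mulr1 mulrC lerDl exprn_ge0 // ltW.
have {}d0 : 0 < d by rewrite lt_neqAle eq_sym dn0.
pose u := d / D; have u0 : 0 < u by rewrite divr_gt0.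
have u1 : u <= 1 by rewrite ler_pdivrMr // mul1r.
have du : d = u * D by rewrite divfK // gt_eqF.
have ex : exists k, t ^+ k < u by exact: expr_lt_small.
have [tk kmin] := ex_minnP ex; case: tk kmin => [|k] tk kmin.
  by rewrite expr0 ltNge u1 in tk.
have {kmin} uk : u <= t ^+ k.
  by rewrite leNgt; apply/negP => /kmin; rewrite ltnn.
have Mtk : M ^+ k * t ^+ k = q ^+ k.
  by rewrite -exprMn /t mulrC divfK // gt_eqF.
have h1 : M ^+ k * d <= q ^+ k * D.
  rewrite du mulrA -Mtk; apply: ler_wpM2r; first exact: ltW.
  by apply: ler_wpM2l => //; rewrite exprn_ge0 // ltW.
have h2 : q ^+ k.+1 <= u `^ a.
  have -> : q ^+ k.+1 = (t ^+ k.+1) `^ a.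
    rewrite -(powR_mulrn _ (ltW t0)) -powRrM mulrC powRrM ta.
    by rewrite powR_mulrn // ltW.
  by apply: ge0_ler_powR; rewrite ?nnegrE ?ltW // exprn_gt0.
apply: le_trans (hg k) _.
have -> : (D + B) / q * D^-1 `^ a * d `^ a = (D + B) / q * u `^ a.
  by rewrite -mulrA -powRM ?invr_ge0 ?ltW // [D^-1 * _]mulrC.
apply: (@le_trans _ _ ((D + B) / q * q ^+ k.+1)).
  by rewrite exprS mulrA divfK ?gt_eqF // mulrDl lerD // [D * _]mulrC.
by rewrite ler_wpM2l // divr_ge0 ?addr_ge0 // ltW.
Qed.

Section Retraction.
Context {R : realType} {X : completeNormedModType R} {C : set X}
  {S : nat -> X -> X} {s q : R} {U : set_system nat}.
Hypothesis Cwc : weakly_compact C.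
Hypothesis s0 : 0 <= s.
Hypothesis q0 : 0 < q.
Hypothesis q1 : q < 1.
Hypothesis SC : forall n x, C x -> C (S n x).
Hypothesis SL : forall n x y, C x -> C y -> `|S n x - S n y| <= s * `|x - y|.
Hypothesis UU : UltraFilter U.
Hypothesis Sq : forall m x z a, C x -> C z -> wlim U (fun n => S n x) z ->
  0 <= a -> U [set n | `|x - S n x| <= a] -> `|z - S m z| <= q * a.

(** [Sq] abstracts the defect estimates of both cases of the theorem, so that they share one
    construction. *)
Lemma holder_retraction_common_fixed : exists r : X -> X,
  [/\ forall x, C x -> C (r x) /\ forall m, S m (r x) = r x,
      forall x, C x -> (forall m, S m x = x) -> r x = x
    & exists K a : R, [/\ 0 < K, 0 < a, a <= 1 &
        forall x y, C x -> C y -> `|r x - r y| <= K * `|x - y| `^ a]].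
Proof.
have [D0 hD0] := weakly_compact_bounded Cwc.
pose D := 2 * `|D0| + 1; have D_gt0 : 0 < D by have := normr_ge0 D0; rewrite /D; lra.
have hD x y : C x -> C y -> `|x - y| <= D.
  move=> /hD0 hx /hD0 hy; apply: le_trans (ler_normB _ _) _.
  by have := ler_norm D0; rewrite /D; lra.
have /choice [L LP] : forall x, exists z, C x -> C z /\ wlim U (fun n => S n x) z.
  move=> x; have [Cx|nCx] := pselect (C x); last by exists x.
  have [z zP] := weakly_compact_wlim Cwc UU (fun n => SC n x Cx).
  by exists z.
have LC k x : C x -> C (iter k L x).
  by move=> Cx; elim: k => //= k /LP[].
pose x_ k x := iter k L x.
have defect k x n : C x -> `|x_ k x - S n (x_ k x)| <= D * q ^+ k.
  move=> Cx; elim: k n => [|k IH] n.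
    by rewrite mulr1; apply: hD => //; exact: SC.
  rewrite exprS mulrCA; have [_ Lw] := LP _ (LC k x Cx).
  apply: (Sq _ _ _ _ _ _ Lw); [exact: LC|exact: (LC k.+1)| |].
    by rewrite mulr_ge0 ?exprn_ge0 // ltW.
  by apply: (@filterS _ U _ setT) filterT => i _; exact: IH.
(* [x_ k.+1 x] is a weak limit of the points [S n (x_ k x)], which all lie in one closed ball about
   [x_ k x]. *)
have move_ k x : C x -> `|x_ k.+1 x - x_ k x| <= D * q ^+ k.
  move=> Cx; have [_ Lw] := LP _ (LC k x Cx).
  apply: wlim_norm_le Lw _; apply: (@filterS _ U _ setT) filterT => n _ /=.
  by rewrite distrC; exact: defect.
have /choice [r rP] : forall x, exists l, C x ->
    forall k, `|l - x_ k x| <= D / (1 - q) * q ^+ k.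
  move=> x; have [Cx|nCx] := pselect (C x); last by exists x.
  have [l hl] := geometric_limit (ltW D_gt0) q0 q1 (fun k => move_ k x Cx).
  by exists l.
pose A := D / (1 - q); have A0 : 0 < A by rewrite divr_gt0 // subr_gt0.
have qA e : 0 < e -> exists k, A * q ^+ k < e.
  move=> e0; have [k hk] := expr_lt_small q0 q1 (divr_gt0 e0 A0).
  by exists k; rewrite mulrC -ltr_pdivlMr.
have rC x : C x -> C (r x).
  (* By weak compactness the iterates have a weak limit in [C] along an ultrafilter; it must be
     their norm limit [r x]. *)
  move=> Cx; have [V [VU oV]] := ultraFilterLemma eventually_filter.
  have [z [Cz xz]] := weakly_compact_wlim Cwc VU (fun k => LC k x Cx).
  suff -> : r x = z by [].
  apply/esym/subr0_eq/norm_small_eq0 => e e0; have [k0 hk] := qA e e0.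
  apply: wlim_norm_le xz _; apply: oV; exists k0 => // k /= k0k.
  rewrite distrC; apply: le_trans (rP x Cx k) _; apply: le_trans (ltW hk).
  by rewrite ler_wpM2l ?(ltW A0) // ler_wiXn2l // ltW.
(* The base is [s + 1] because the interpolation asks for a base of at least 1. *)
have xL k x y : C x -> C y -> `|x_ k x - x_ k y| <= (s + 1) ^+ k * `|x - y|.
  move=> Cx Cy; elim: k => [|k IH]; first by rewrite mul1r.
  have [_ Lx] := LP _ (LC k x Cx); have [_ Ly] := LP _ (LC k y Cy).
  suff : `|x_ k.+1 x - x_ k.+1 y - 0| <= (s + 1) ^+ k.+1 * `|x - y|.
    by rewrite subr0.
  apply: (wlim_norm_le 0 _ (wlimB _ Lx Ly)).
  apply: (@filterS _ U _ setT) filterT => n _ /=; rewrite subr0.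
  apply: le_trans (SL n _ _ (LC k x Cx) (LC k y Cy)) _.
  rewrite exprS -mulrA; apply: ler_pM => //; first by rewrite lerDl.
exists r; split.
- move=> x Cx; split=> [|m]; first exact: rC.
  apply/subr0_eq/norm_small_eq0 => e e0.
  have s3 : 0 < s + 3 by move: s0; lra.
  have [k hk] := qA (e / (s + 3)) (divr_gt0 e0 s3).
  have h1 := rP x Cx k.
  have h2 := SL m _ _ (rC x Cx) (LC k x Cx).
  have DA : D * q ^+ k <= A * q ^+ k.
    apply: ler_wpM2r; first by rewrite exprn_ge0 // ltW.
    by rewrite /A ler_pdivlMr ?subr_gt0 // ler_piMr ?(ltW D_gt0) // gerBl ltW.
  have h3 := defect k x m Cx; rewrite distrC in h3.
  rewrite ltr_pdivlMr // in hk.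
  have h4 : s * `|r x - x_ k x| <= s * (A * q ^+ k) by exact: ler_wpM2l.
  rewrite -(subrKA (S m (x_ k x))); apply: le_trans (ler_normD _ _) _.
  rewrite -[X in _ + `|X|](subrKA (x_ k x)).
  apply: le_trans (lerD (lexx _) (ler_normD _ _)) _.
  rewrite -/A in h1; rewrite -/(x_ k x) in h2.
  rewrite (distrC (x_ k x)).
  by move: h1 h2 h3 h4 hk DA (mulr_ge0 (ltW A0) (exprn_ge0 k (ltW q0))); lra.
(* At a common fixed point the sequence defining [L x] is constant, so every iterate equals [x]. *)
- move=> x Cx fx; have Lx z : wlim U (fun n => S n x) z -> z = x.
    move=> xz; apply/subr0_eq/norm_small_eq0 => e e0.
    apply: wlim_norm_le xz _; apply: (@filterS _ U _ setT) filterT => n _ /=.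
    by rewrite fx subrr normr0 ltW.
  have xk k : x_ k x = x.
    elim: k => [//|k IH]; rewrite /x_ iterS -/(x_ k x) IH.
    exact: Lx (LP x Cx).2.
  apply/subr0_eq/norm_small_eq0 => e e0; have [k hk] := qA e e0.
  by have := rP x Cx k; rewrite xk => h; exact: le_trans h (ltW hk).
(* The constant [2 * A] covers the tails from the iterates to their limits at [x] and at [y]. *)
- have [|||K [a [K0 a0 a1 h]]] := @holder_interpolation R q (s + 1) (2 * A) D q0 q1.
  + by rewrite lerDr.
  + by rewrite mulr_ge0 // ltW.
  + by [].
  exists K, a; split => // x y Cx Cy; apply: h; rewrite ?normr_ge0 ?hD // => k.
  have := xL k x y Cx Cy; have := rP x Cx k; have := rP y Cy k.
  rewrite -/A (distrC (r y)).
  have -> : r x - r y = (r x - x_ k x) + (x_ k x - x_ k y) + (x_ k y - r y).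
    by rewrite !subrKA.
  move=> h1 h2 h3; apply: le_trans (ler_normD _ _) _.
  have := ler_normD (r x - x_ k x) (x_ k x - x_ k y); lra.
Qed.

End Retraction.

(** * Constants and times for the semigroup *)

Lemma ereal_between {R : realType} {x y : \bar R} :
  (0 <= x)%E -> (x < y)%E ->
  exists s k : R, [/\ 0 < s, s < k, (x < s%:E)%E & (k%:E < y)%E].
Proof.
case: x => [x|_|//]; last by rewrite ltNge leey.
rewrite lee_fin => x0; case: y => [y|_|//].
  rewrite lte_fin => xy; exists (x + (y - x) / 3), (x + (y - x) * 2 / 3).
  by rewrite !lte_fin; split; lra.
by exists (x + 1), (x + 2); rewrite lte_fin ltry; split=> //; lra.
Qed.

Lemma liminf_lip_ge0 {R : realType} {X : normedModType R} (G : set R)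
    (C : set X) (T : R -> X -> X) : (0 <= liminf_lip G C T)%E.
Proof.
rewrite /liminf_lip limf_einfE; apply: le_ereal_sup_tmp.
exists (ereal_inf ((fun t => lip_const C (T t)) @` setT)).
  by exists setT => //; exact: filterT.
apply/ereal_infP => _ [t _ <-]; apply/ereal_infP => _ [k [k0 _] <-].
by rewrite lee_fin.
Qed.

(** The infimum of the Lipschitz constants over any tail of [G] is at most their lower limit. *)
Lemma liminf_lip_lt {R : realType} {X : normedModType R} {G : set R}
    {C : set X} {T : R -> X -> X} {s : R} (M : R) :
  (liminf_lip G C T < s%:E)%E ->
  exists t, [/\ G t, M < t &
    forall x y, C x -> C y -> `|T t x - T t y| <= s * `|x - y|].
Proof.
rewrite /liminf_lip limf_einfE => lt.
pose V := [set t | G t /\ M < t].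
have : (ereal_inf ((fun t => lip_const C (T t)) @` V) < s%:E)%E.
  apply: le_lt_trans lt; apply: ereal_sup_ubound; exists V => //.
  by exists M; split=> [|t Mt Gt]; [exact: num_real|split].
move=> /ereal_inf_lt [_ [t [Gt Mt] <-]] /ereal_inf_lt [_ [k [k0 kL] <-]].
rewrite lte_fin => ks; exists t; split=> // x y Cx Cy.
by apply: le_trans (kL x y Cx Cy) _; rewrite ler_wpM2r // ltW.
Qed.
Theorem theorem4p2 (R : realType) (X : completeNormedModType R)
    (G : set R) (C : set X) (T : R -> X -> X)
    (hG : admissible_times G)
    (C0 : C !=set0) (Cconv : @convex_set R X C) (Cwc : weakly_compact C)
    (hT : semigroup_on G C T)
    (har : asymptotically_regular G C T)
    (hab : (liminf_lip G C T < (Num.sqrt (WCS X))%:E)%E \/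
           (liminf_lip G C T < 1 + opial_modulus X 1)%E) :
  (exists x, Fix G C T x) /\ holder_retract C (Fix G C T).
Proof.
have [UC0 TD] := hT.
have [s [q [s0 q0 q1 Ls contr]]] : exists s q : R,
    [/\ 0 < s, 0 < q, q < 1, (liminf_lip G C T < s%:E)%E &
    forall (S : nat -> X -> X) (U : set_system nat),
      (forall n x, C x -> C (S n x)) ->
      (forall n x y, C x -> C y -> `|S n x - S n y| <= s * `|x - y|) ->
      (forall m x e, C x -> 0 < e -> \oo [set n | `|S m (S n x) - S n x| < e]) ->
      UltraFilter U -> \oo `<=` U ->
      forall m x z a, C x -> C z -> wlim U (fun n => S n x) z ->
        0 <= a -> U [set n | `|x - S n x| <= a] -> `|z - S m z| <= q * a].
  (* [s] is to bound the Lipschitz constants and [k] lies below the geometric bound; the gap between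
     them makes [q < 1]. *)
  case: hab => /(ereal_between (liminf_lip_ge0 G C T)) [s [k [s0 sk Ls kb]]];
    have k0 : 0 < k by [exact: lt_trans sk].
  (* In case (a) [k] lies below the square root, so the estimate with [WCS X] is applied to
     [k * k]. *)
  - exists s, (s * s / (k * k)); split=> //.
    + by rewrite divr_gt0 // mulr_gt0.
    + by rewrite ltr_pdivrMr ?mulr_gt0 // mul1r ltr_pM // ltW.
    move=> S U SC SL Sreg UU oU m x z a Cx Cz xz a0 Ua.
    have kW : k * k < WCS X.
      move: kb; rewrite lte_fin => kb.
      (* [Num.sqrt] vanishes at nonpositive arguments, so a positive [k] below it makes [WCS X]
         positive. *)
      have W0 : 0 < WCS X by rewrite -sqrtr_gt0; exact: lt_trans kb.
      rewrite -expr2 -(sqr_sqrtr (ltW W0)).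
      by rewrite ltrXn2r // ?nnegrE ltW.
    have := defect_contraction_WCS Cwc (ltW s0) SC SL Sreg UU oU m
      (mulr_ge0 (ltW k0) (ltW k0)) kW Cx Cz xz Ua.
    by rewrite [_ / _ * _]mulrAC ler_pdivlMr ?mulr_gt0 // mulrC.
  - exists s, (s / k); split=> //.
    + by rewrite divr_gt0.
    + by rewrite ltr_pdivrMr // mul1r.
    move=> S U SC SL Sreg UU oU m x z a Cx Cz xz a0 Ua.
    have := defect_contraction_opial Cwc (ltW s0) SC SL Sreg UU oU m
      sk kb Cx Cz xz a0 Ua.
    by rewrite [_ / _ * _]mulrAC ler_pdivlMr // mulrC.
have /choice [t tP] := fun n : nat => liminf_lip_lt n%:R Ls.
pose S n := T (t n).
have Gt n : G (t n) by have [] := tP n.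
have SC n x : C x -> C (S n x) by exact: UC0.
have SL n x y : C x -> C y -> `|S n x - S n y| <= s * `|x - y|.
  by have [_ _] := tP n; exact.
(* Stated for every [h] in [G], because the passage from the times [t n] to the whole semigroup uses
   it again. *)
have reg h x e : G h -> C x -> 0 < e ->
    \oo [set n | `|T h (S n x) - S n x| < e].
  move=> Gh Cx e0; have /cvgrPdist_lt /(_ e e0) [M [_ hM]] := har x h Cx Gh.
  exists (Num.trunc M).+1 => // n /= Mn; have [_ nt _] := tP n.
  have Mt : M < t n.
    apply: lt_trans nt; apply: lt_le_trans (truncnS_gt M) _.
    by rewrite ler_nat.
  have := hM (t n) Mt (Gt n).
  by rewrite sub0r normrN normr_id (addrC (t n)) TD.
have [U [UU oU]] := ultraFilterLemma eventually_filter.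
have Sreg m x e (Cx : C x) (e0 : 0 < e) := reg (t m) x e (Gt m) Cx e0.
have [r [rC rid [K [a [K0 a0 a1 rh]]]]] :=
  holder_retraction_common_fixed Cwc (ltW s0) q0 q1 SC SL UU
    (contr S U SC SL Sreg UU oU).
(* Since [r x] is fixed by every [S n], asymptotic regularity at time [h] bounds the distance from
   [T h (r x)] to [r x] by every positive [e]. *)
have rF x : C x -> Fix G C T (r x).
  move=> /rC [Cr fr]; split=> // h Gh; apply/subr0_eq/norm_small_eq0 => e e0.
  have [n /=] := filter_ex (reg h (r x) e Gh Cr e0).
  by rewrite fr => /ltW.
split; first by have [x Cx] := C0; exists (r x); exact: rF.
split; first by move=> x [].
exists r; split => //; first by move=> x [Cx fx]; apply: rid => // m; exact: fx.
by exists K, a.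
Qed.
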